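(* Let $A\subset\mathbb R^d$ be a finite set in general position, affinely spanning $\mathbb R^d$, with $Q=\mathrm{Conv}(A)$. Let $\overset{\bullet}{\mathfrak g}_A=\bigoplus_{(Q',A')\subset(Q,A)}E_{A'}$ be the $L_\infty$-algebra of marked subpolytopes of $(Q,A)$, and let $\mathfrak g_A=\bigoplus_{Q'\subset(Q,A)}E_{A\cap Q'}\subset\overset{\bullet}{\mathfrak g}_A$ be the subspace spanned by the summands of geometric marked subpolytopes. Then $\mathfrak g_A$ is an $L_\infty$-subalgebra of $\overset{\bullet}{\mathfrak g}_A$, with trivial differential.
   Context: General position: any $p\le d+1$ points of $A$ are the vertices of a $(p-1)$-simplex. A marked polytope is a pair $(Q',A')$ with $A'$ finite and $Q'=\mathrm{Conv}(A')$; it is a marked subpolytope of $(Q,A)$ if $A'\subset A$ (here always of full dimension $d$), and it is geometric if $A'=A\cap Q'$. A polyhedral subdivision of $(Q',A')$ is a collection $\mathcal P''=\{(Q''_\nu,A''_\nu)\}$ of $d$-dimensional marked subpolytopes of $(Q',A')$ with $\bigcup Q''_\nu=Q'$, each $Q''_\nu\cap Q''_\mu$ a common face (possibly empty), and $A''_\nu,A''_\mu$ having the same intersection with $Q''_\nu\cap Q''_\mu$. It is regular if there is a continuous convex function on $Q'$ whose maximal domains of affine linearity are exactly the $Q''_\nu$. Regular subdivisions are ordered by refinement. The secondary polytope $\Sigma(A')\subset\mathbb R^{A'}$ is the convex hull of the vectors $\phi_T(\omega)=\sum_{\Delta\in T,\,\omega\in\mathrm{Vert}(\Delta)}\mathrm{Vol}(\Delta)$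 over regular triangulations $T$ of $(Q',A')$. Known facts: $\dim\Sigma(A')=|A'|-d-1$; faces of $\Sigma(A')$ are in order-preserving bijection $\mathcal P''\mapsto F_{\mathcal P''}$ with regular subdivisions; $F_{\mathcal P''}\cong\prod_\nu\Sigma(A''_\nu)$. Coarse means $F_{\mathcal P''}$ has codimension 1. $\mathbf k$ is a field of characteristic 0; $\mathrm{or}(F)=H_c^{\dim F}(\mathrm{Int}(F),\mathbf k)$. Put $V_{A'}=\mathrm{or}(\Sigma(A'))[\dim\Sigma(A')]$ and $V=\bigoplus_{(Q',A')\subset(Q,A)}V_{A'}$. The graded commutative algebra $S^\bullet(V)$ carries the derivation differential $d$, $d^2=0$, given on $V_{A'}$ by $\sum_{\mathcal P''}d_{\mathcal P''}$ over coarse regular subdivisions of $(Q',A')$, where $d_{\mathcal P''}:V_{A'}\to\bigodot_\nu V_{A''_\nu}\cong\mathrm{or}(F_{\mathcal P''})[\dim F_{\mathcal P''}]$ is the component of the cellular chain differential of $\Sigma(A')$ from the top cell to the facet $F_{\mathcal P''}$. An $L_\infty$-structure on a finite-dimensional graded space $\mathfrak h$ is an algebra differential on $S^\bullet(\mathfrak h^*[-1])$ preserving the ideal $S^\bullet_+$ of positive symmetric degree; its operations are denoted $\lambda_n:\mathfrak h^{\otimes n}\to\mathfrak h$, $n\ge1$, with $\lambda_1$ the differential. $\overset{\bullet}{\mathfrak g}_A=V^*[-1]$ with $E_{A'}=V_{A'}^*[-1]=\mathrm{or}(\Sigma(A'))^*[-1-\dim\Sigma(A')]$, and the $L_\infty$-structure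 given by $d$. An $L_\infty$-subalgebra is a graded subspace closed under all $\lambda_n$. *)

(* Defs.v *)
From HB Require Import structures.
From mathcomp Require Import all_boot all_order all_algebra finmap.
From mathcomp Require Import all_classical all_reals all_analysis.
From mathcomp Require Import zify.
Set Implicit Arguments.
Unset Strict Implicit.
Unset Printing Implicit Defensive.
Import Order.TTheory GRing.Theory Num.Theory numFieldNormedType.Exports.
Local Open Scope ring_scope.

(** Let V be a graded vector space over a field k of characteristic 0, with a
   finite homogeneous basis (x_i) and |x_i| = deg i.  The graded-commutative
   algebra S(V) is realised as the algebra of graded-symmetric tensors, i.e.
   the finitely supported functions f on words such that
     f(.. a b ..) = (-1)^(|a||b|) f(.. b a ..),
   under the signed shuffle product.  The monomial x_i1 ... x_in is the tensor
   whose value at the word j1 ... jn is the sum of the Koszul signs of the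
   permutations taking (i1, ..., in) to (j1, ..., jn): the value of f at
   j1 ... jn is its pairing with the product of the dual basis vectors
   j1, ..., jn.  In characteristic 0 this is the usual S(V). *)

Section ShuffleProduct.
Variables (k : fieldType) (I : finType) (deg : I -> int).
Implicit Types (a b : I) (u v w s t : seq I).

Definition wdeg w : int := \sum_(a <- w) deg a.

Lemma wdeg_cons a w : wdeg (a :: w) = deg a + wdeg w.
Proof. by rewrite /wdeg big_cons. Qed.

Lemma wdeg_cat u v : wdeg (u ++ v) = wdeg u + wdeg v.
Proof. by rewrite /wdeg big_cat. Qed.

Lemma perm_wdeg u v : perm_eq u v -> wdeg u = wdeg v.
Proof. exact: perm_big. Qed.

Definition ksg (p q : int) : k := (-1) ^ (p * q).

Lemma ksgDl p q r : ksg (p + q) r = ksg p r * ksg q r.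
Proof. by rewrite /ksg mulrDl expfzDr // oppr_eq0 oner_eq0. Qed.

Lemma ksgDr p q r : ksg r (p + q) = ksg r p * ksg r q.
Proof. by rewrite /ksg mulrDr expfzDr // oppr_eq0 oner_eq0. Qed.

Lemma ksgC p q : ksg p q = ksg q p.
Proof. by rewrite /ksg mulrC. Qed.

Lemma ksg0 p : ksg p 0 = 1.
Proof. by rewrite /ksg mulr0 expr0z. Qed.

Lemma ksgK p q : ksg p q * ksg p q = 1.
Proof.
by rewrite /ksg -exprMz_comm ?unitrN1 // mulrNN mulr1 exp1rz.
Qed.

Lemma ksgNl p q : ksg (- p) q = ksg p q.
Proof.
rewrite -[LHS]mulr1 -(ksgK p q) mulrA -ksgDl addNr.
by rewrite ksgC ksg0 mul1r.
Qed.

Definition shuf : Type := seq I -> k.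

HB.instance Definition _ := GRing.Lmodule.copy shuf (seq I -> k^o).

Implicit Types f g h : shuf.

(* Contraction with the dual basis vector of x_a. *)
Definition con a f : shuf := fun w => f (a :: w).

Definition twist (p : int) f : shuf := fun w => ksg p (wdeg w) * f w.

(* The sum over all ways to split w into complementary subwords u and v of
   (+/-) f(u) g(v), with the Koszul sign of the unshuffle w -> u v. *)
Fixpoint shmul f g w : k :=
  if w is a :: w' then
    shmul (con a f) g w' + shmul (twist (deg a) f) (con a g) w'
  else f [::] * g [::].

Definition shone : shuf := fun w => (w == [::])%:R.

Lemma conD a f g : con a (f + g) = con a f + con a g.
Proof. by apply/funext. Qed.

Lemma conZ a c f : con a (c *: f) = c *: con a f.
Proof. by apply/funext. Qed.

Lemma twistD p f g : twist p (f + g) = twist p f + twist p g.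
Proof. by apply/funext => w; rewrite /twist mulrDr. Qed.

Lemma twistZ p c f : twist p (c *: f) = c *: twist p f.
Proof. by apply/funext => w; rewrite /twist; exact: mulrCA. Qed.

Lemma con_twist a p f : con a (twist p f) = ksg p (deg a) *: twist p (con a f).
Proof.
by apply/funext => w; rewrite /con /twist wdeg_cons ksgDr -mulrA.
Qed.

Lemma twist_twist p q f : twist p (twist q f) = twist (p + q) f.
Proof. by apply/funext => w; rewrite /twist mulrA ksgDl. Qed.

Lemma con_mul a f g :
  con a (shmul f g) = (shmul (con a f) g : shuf)
                      + (shmul (twist (deg a) f) (con a g) : shuf).
Proof. by apply/funext. Qed.

Lemma shmulDl f g h : shmul (f + g) h = (shmul f h : shuf) + (shmul g h : shuf).
Proof.
apply/funext => w; change (shmul (f + g) h w = shmul f h w + shmul g h w).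
elim: w f g h => [|a w IH] f g h /=; first exact: mulrDl.
by rewrite conD twistD !IH addrACA.
Qed.

Lemma shmulDr f g h : shmul h (f + g) = (shmul h f : shuf) + (shmul h g : shuf).
Proof.
apply/funext => w; change (shmul h (f + g) w = shmul h f w + shmul h g w).
elim: w f g h => [|a w IH] f g h /=; first exact: mulrDr.
by rewrite conD !IH addrACA.
Qed.

Lemma shmulZl c f g : shmul (c *: f) g = c *: (shmul f g : shuf).
Proof.
apply/funext => w; change (shmul (c *: f) g w = c * shmul f g w).
elim: w f g => [|a w IH] f g /=.
  by change (c * f [::] * g [::] = c * (f [::] * g [::])); rewrite mulrA.
by rewrite conZ twistZ !IH mulrDr.
Qed.

Lemma shmulZr c f g : shmul f (c *: g) = c *: (shmul f g : shuf).
Proof.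
apply/funext => w; change (shmul f (c *: g) w = c * shmul f g w).
elim: w f g => [|a w IH] f g /=.
  by change (f [::] * (c * g [::]) = c * (f [::] * g [::])); rewrite mulrCA.
by rewrite conZ !IH mulrDr.
Qed.

Lemma twist_mul p f g :
  twist p (shmul f g) = shmul (twist p f) (twist p g).
Proof.
apply/funext => w; rewrite /twist -/(twist p f) -/(twist p g).
elim: w f g => [|a w IH] f g /=.
  by rewrite /twist /= /wdeg big_nil ksg0 !mul1r.
rewrite !con_twist shmulZl shmulZr twist_twist addrC -twist_twist addrC.
change (ksg p (wdeg (a :: w)) *
   (shmul (con a f) g w + shmul (twist (deg a) f) (con a g) w) =
   ksg p (deg a) * shmul (twist p (con a f)) (twist p g) w +
   ksg p (deg a) * shmul (twist (deg a) (twist p f)) (twist p (con a g)) w).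
rewrite twist_twist [deg a + p]addrC -twist_twist -!IH wdeg_cons ksgDr.
by rewrite -mulrDr -mulrDr mulrA.
Qed.

Lemma shmulA f g h : shmul f (shmul g h) = shmul (shmul f g) h.
Proof.
apply/funext => w; elim: w f g h => [|a w IH] f g h /=; first exact: mulrA.
rewrite !con_mul twist_mul shmulDl shmulDr.
change (shmul (con a f) (shmul g h) w +
  (shmul (twist (deg a) f) (shmul (con a g) h) w +
   shmul (twist (deg a) f) (shmul (twist (deg a) g) (con a h)) w) =
  shmul (shmul (con a f) g) h w +
   shmul (shmul (twist (deg a) f) (con a g)) h w +
   shmul (shmul (twist (deg a) f) (twist (deg a) g)) (con a h) w).
by rewrite !IH addrA.
Qed.

(* A product vanishes at w as soon as every term of the unshuffle sum does. *)
Lemma shmul_eq0 f g w :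
    (forall u v, perm_eq (u ++ v) w -> f u * g v = 0) -> shmul f g w = 0.
Proof.
elim: w f g => [|a w IH] f g fg0 /=; first exact: fg0.
rewrite !IH ?addr0 // => u v uv.
  rewrite /twist /con -mulrA fg0 ?mulr0 //.
  by rewrite -cat_rcons -cats1 perm_catAC perm_catC /= perm_cons.
by rewrite /con fg0 //= perm_cons.
Qed.

Lemma shmul0l g : shmul (0 : shuf) g = (0 : shuf).
Proof. by apply/funext => w; apply: shmul_eq0 => u v _; exact: mul0r. Qed.

Lemma shmul0r f : shmul f (0 : shuf) = (0 : shuf).
Proof. by apply/funext => w; apply: shmul_eq0 => u v _; exact: mulr0. Qed.

Lemma twist_one p : twist p shone = shone.
Proof.
apply/funext => -[|a w]; rewrite /twist /shone /= ?mulr0 //.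
by rewrite /wdeg big_nil ksg0 mulr1.
Qed.

Lemma shmul1l f : shmul shone f = f.
Proof.
apply/funext => w; elim: w f => [|a w IH] f /=; first exact: mul1r.
have -> : con a shone = 0 by apply/funext.
by rewrite shmul0l twist_one IH; exact: add0r.
Qed.

Lemma shmul1r f : shmul f shone = f.
Proof.
apply/funext => w; elim: w f => [|a w IH] f /=; first exact: mulr1.
have -> : con a shone = 0 by apply/funext.
by rewrite shmul0r IH; exact: addr0.
Qed.

Lemma shone_neq0 : shone != (0 : shuf).
Proof.
apply/eqP => /(congr1 (fun f : shuf => f [::])) /= /eqP.
by rewrite /shone /=; apply/negP; exact: oner_neq0.
Qed.

HB.instance Definition _ := GRing.Zmodule_isNzRing.Build shuf
  shmulA shmul1l shmul1r (fun f g h => shmulDl f g h)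
  (fun f g h => shmulDr g h f) shone_neq0.

Lemma shuf_scaleAl c f g : c *: (f * g) = (c *: f) * g.
Proof. by rewrite [RHS](shmulZl c f g). Qed.

HB.instance Definition _ := GRing.Lmodule_isLalgebra.Build k shuf shuf_scaleAl.

Lemma shuf_scaleAr c f g : c *: (f * g) = f * (c *: g).
Proof. by rewrite [RHS](shmulZr c f g). Qed.

HB.instance Definition _ := GRing.Lalgebra_isAlgebra.Build k shuf shuf_scaleAr.

Definition gsym f := forall s a b t,
  f (s ++ a :: b :: t) = ksg (deg a) (deg b) * f (s ++ b :: a :: t).

Definition bounded_length f := exists n, forall w, (n < size w)%N -> f w = 0.

Definition symtens : {pred shuf} :=
  fun f => `[< gsym f /\ bounded_length f >].

Lemma gsym_con a f : gsym f -> gsym (con a f).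
Proof. by move=> fS s; exact: (fS (a :: s)). Qed.

Lemma gsym_twist p f : gsym f -> gsym (twist p f).
Proof.
move=> fS s a b t; rewrite /twist fS mulrCA; congr (_ * (ksg p _ * _)).
by apply: perm_wdeg; rewrite perm_cat2l -cat1s -(cat1s b) perm_catCA.
Qed.

Lemma gsym_mul f g : gsym f -> gsym g -> gsym (f * g).
Proof.
move=> + + s a b t; elim: s f g => [|c s IH] f g fS gS.
  change (shmul (con b (con a f)) g t
      + shmul (twist (deg b) (con a f)) (con b g) t
    + (shmul (con b (twist (deg a) f)) (con a g) t
      + shmul (twist (deg b) (twist (deg a) f)) (con b (con a g)) t)
    = ksg (deg a) (deg b) *
    (shmul (con a (con b f)) g t
      + shmul (twist (deg a) (con b f)) (con a g) t
    + (shmul (con a (twist (deg b) f)) (con b g) t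
      + shmul (twist (deg a) (twist (deg b) f)) (con a (con b g)) t))).
  have swap x : gsym x ->
      con b (con a x) = ksg (deg a) (deg b) *: con a (con b x).
    by move=> xS; apply/funext => w; exact: (xS [::]).
  rewrite (swap f fS) (swap g gS) !con_twist !shmulZl shmulZr !twist_twist.
  rewrite [deg b + deg a]addrC.
  set c := ksg (deg a) (deg b).
  change (c * shmul (con a (con b f)) g t
      + shmul (twist (deg b) (con a f)) (con b g) t
    + (c * shmul (twist (deg a) (con b f)) (con a g) t
      + c * shmul (twist (deg a + deg b) f) (con a (con b g)) t)
    = c *
    (shmul (con a (con b f)) g t
      + shmul (twist (deg a) (con b f)) (con a g) t
    + (ksg (deg b) (deg a) * shmul (twist (deg b) (con a f)) (con b g) t
      + shmul (twist (deg a + deg b) f) (con a (con b g)) t))).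
  rewrite [ksg (deg b) _]ksgC -/c !mulrDr (mulrA c c) ksgK mul1r.
  by rewrite !addrA; congr (_ + _); rewrite addrAC.
change ((con c f * g) (s ++ [:: a, b & t])
    + (twist (deg c) f * con c g) (s ++ [:: a, b & t])
  = ksg (deg a) (deg b) * ((con c f * g) (s ++ [:: b, a & t])
    + (twist (deg c) f * con c g) (s ++ [:: b, a & t]))).
rewrite !(IH (con c f)) ?(IH (twist (deg c) f)) -?mulrDr //.
- exact: gsym_twist.
- exact: gsym_con.
- exact: gsym_con.
Qed.

Lemma symtens_subalg : subalg_closed symtens.
Proof.
split.
- apply/asboolP; split; last by exists 0%N => -[].
  have one0 x w : (1 : shuf) (x :: w) = 0 by [].
  by move=> [|c s] a b t; rewrite !one0 mulr0.
- move=> c f g /asboolP[fS [m fm]] /asboolP[gS [n gn]]; apply/asboolP; split.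
    move=> s a b t; change (c * f (s ++ [:: a, b & t]) + g (s ++ [:: a, b & t])
      = ksg (deg a) (deg b) *
        (c * f (s ++ [:: b, a & t]) + g (s ++ [:: b, a & t]))).
    by rewrite fS gS mulrDr mulrCA.
  exists (maxn m n) => w; rewrite gtn_max => /andP[mw nw].
  by change (c * f w + g w = 0); rewrite fm // gn // mulr0 addr0.
- move=> f g /asboolP[fS [m fm]] /asboolP[gS [n gn]]; apply/asboolP; split.
    exact: gsym_mul.
  exists (m + n)%N => w mnw; apply: shmul_eq0 => u v /perm_size.
  rewrite size_cat => uvw; have [um|um] := leqP (size u) m.
    rewrite (gn v) ?mulr0 // -(ltn_add2l m) (leq_trans mnw) // -uvw.
    by rewrite leq_add2r.
  by rewrite fm ?mul0r.
Qed.

HB.instance Definition _ := GRing.isSubalgClosed.Build k shuf symtens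
  symtens_subalg.

Record symalg := SymAlg { symval :> shuf; symvalP : symval \in symtens }.

HB.instance Definition _ := [isSub for symval].
HB.instance Definition _ := [Choice of symalg by <:].
HB.instance Definition _ := [SubChoice_isSubAlgebra of symalg by <:].

Lemma gen_subproof i : (fun w => (w == [:: i])%:R : k) \in symtens.
Proof.
apply/asboolP; split; last first.
  by exists 1%N => -[|a [|b w]] //= _; rewrite eqseq_cons andbF.
have neq s x y t : (s ++ [:: x, y & t] == [:: i]) = false.
  by apply/negbTE/eqP => /(congr1 size); rewrite size_cat /= !addnS.
by move=> s a b t; rewrite !neq mulr0.
Qed.

Definition gen i : symalg := SymAlg (gen_subproof i).

Lemma partial_subproof a (f : symalg) : con a f \in symtens.
Proof.
have /asboolP[fS [n fn]] := symvalP f; apply/asboolP; split.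
  exact: gsym_con.
by exists n => w nw; apply: fn; exact: ltnW.
Qed.

Definition partial a (f : symalg) : symalg := SymAlg (partial_subproof a f).

Lemma koszul_subproof p (f : symalg) : twist p f \in symtens.
Proof.
have /asboolP[fS [n fn]] := symvalP f; apply/asboolP; split.
  exact: gsym_twist.
by exists n => w nw; rewrite /twist fn // mulr0.
Qed.

(* f |-> (-1)^(p|f|) f on homogeneous elements. *)
Definition koszul p (f : symalg) : symalg := SymAlg (koszul_subproof p f).

Definition homog (p : int) (f : symalg) := forall w, symval f w != 0 -> wdeg w = p.

Lemma symvalM (f h : symalg) : symval (f * h) = shmul (symval f) (symval h).
Proof. exact: (rmorphM (\val : symalg -> shuf)). Qed.

Lemma symvalD (f h : symalg) : symval (f + h) = symval f + symval h.
Proof. exact: (raddfD (\val : symalg -> shuf)). Qed.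

Lemma symvalZ c (f : symalg) : symval (c *: f) = c *: symval f.
Proof. exact: (linearZZ (\val : symalg -> shuf)). Qed.

Lemma partialM i (f h : symalg) :
  partial i (f * h) = partial i f * h + koszul (deg i) f * partial i h.
Proof.
apply/val_inj; rewrite [RHS]symvalD !symvalM -con_mul.
by rewrite -[in RHS]symvalM.
Qed.

Lemma mul_homogC p (f h : symalg) : homog p f -> f * h = koszul p h * f.
Proof.
rewrite /homog => fp.
apply/val_inj; rewrite [LHS]symvalM [RHS]symvalM; apply/funext => w /=.
elim: w p (symval f) (symval h) fp => {f h} [|a w IH] p f g fp /=.
  by rewrite /twist /wdeg big_nil ksg0 mul1r mulrC.
have twistE : twist (deg a) f = ksg (deg a) p *: f.
  apply/funext => u; rewrite /twist.
  change (ksg (deg a) (wdeg u) * f u = ksg (deg a) p * f u).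
  by have [->|/fp ->] := eqVneq (f u) 0; rewrite ?mulr0.
have cp : forall u, con a f u != 0 -> wdeg u = p - deg a.
  by move=> u /fp; rewrite wdeg_cons => <-; rewrite addrAC subrr add0r.
rewrite (IH _ _ _ cp) twistE con_twist !shmulZl twist_twist.
change (shmul (twist (p - deg a) g) (con a f) w
  + ksg (deg a) p * shmul f (con a g) w
  = ksg p (deg a) * shmul (twist p (con a g)) f w
  + shmul (twist (deg a + p) g) (con a f) w).
rewrite (IH _ _ _ fp) [ksg p _]ksgC addrC; congr (_ + shmul _ _ _).
by apply/funext => u; rewrite /twist ksgDl ksgNl -ksgDl addrC.
Qed.

Lemma homog0 p : homog p 0.
Proof. by move=> w /=; rewrite eqxx. Qed.

Lemma homogZ p c (f : symalg) : homog p f -> homog p (c *: f).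
Proof.
move=> fp w; rewrite symvalZ => cf; apply: fp; apply: contraNneq cf => fw.
by change (c * symval f w == 0); rewrite fw mulr0.
Qed.

Lemma homogD p (f h : symalg) : homog p f -> homog p h -> homog p (f + h).
Proof.
move=> fp hp w; rewrite symvalD; change (symval f w + symval h w != 0 -> wdeg w = p).
have [->|/fp -> //] := eqVneq (symval f w) 0.
by rewrite add0r => /hp.
Qed.

Lemma homog_gen i : homog (deg i) (gen i).
Proof.
move=> w /=; have [-> _|_] := eqVneq w [:: i]; last by rewrite eqxx.
by rewrite /wdeg big_seq1.
Qed.

Lemma homog1 : homog 0 1.
Proof.
case=> [_|a w]; first by rewrite /wdeg big_nil.
by change ((0 : k) != 0 -> wdeg (a :: w) = 0); rewrite eqxx.
Qed.

Lemma homogM p q (f h : symalg) : homog p f -> homog q h -> homog (p + q) (f * h).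
Proof.
move=> fp hq w; rewrite symvalM; apply: contraNeq => wpq; apply/eqP.
apply: shmul_eq0 => u v /perm_wdeg; rewrite wdeg_cat => uvw.
have [->|/fp up] := eqVneq (symval f u) 0; first by rewrite mul0r.
have [->|/hq vq] := eqVneq (symval h v) 0; first by rewrite mulr0.
by rewrite -uvw up vq eqxx in wpq.
Qed.

(* The linear map of S(V) sending x_i to g i which, when g i has degree
   deg i + 1, is a derivation of degree 1; see derivation_gen, derivation_linear
   and derivationM. *)
Definition derivation (g : I -> symalg) (f : symalg) : symalg :=
  \sum_(i : I) g i * partial i f.

Lemma derivation_gen (g : I -> symalg) i : derivation g (gen i) = g i.
Proof.
rewrite /derivation (bigD1 i) //= big1 ?addr0 => [|j ji]; last first.
  suff -> : partial j (gen i) = 0 by rewrite mulr0.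
  apply/val_inj/funext => w /=; rewrite /con /= eqseq_cons.
  by rewrite (negbTE ji).
suff -> : partial i (gen i) = 1 by rewrite mulr1.
by apply/val_inj/funext => w /=; rewrite /con /= eqseq_cons eqxx.
Qed.

Lemma derivation_linear (g : I -> symalg) c (f h : symalg) :
  derivation g (c *: f + h) = c *: derivation g f + derivation g h.
Proof.
rewrite /derivation scaler_sumr -big_split; apply: eq_bigr => i _ /=.
rewrite scalerAr -mulrDr; congr (_ * _).
exact: val_inj.
Qed.

Lemma derivationM (g : I -> symalg) (f h : symalg) :
    (forall i, homog (deg i + 1) (g i)) ->
  derivation g (f * h) = derivation g f * h + koszul 1 f * derivation g h.
Proof.
move=> gdeg; rewrite /derivation mulr_suml mulr_sumr -big_split /=.
apply: eq_bigr => i _; rewrite partialM mulrDr !mulrA; congr (_ + _ * _).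
rewrite (mul_homogC _ (gdeg i)); congr (_ * _); apply/val_inj => /=.
rewrite twist_twist; apply/funext => w; rewrite /twist addrAC.
by rewrite 2!ksgDl ksgK mul1r.
Qed.

End ShuffleProduct.

(** h is a finite-dimensional graded space with homogeneous basis (e_i), e_i of
   degree deg i; the dual basis (x_i) of V = h^*[-1] has |x_i| = 1 - deg i. *)

Section Linfty.
Variables (k : fieldType) (I : finType) (deg : I -> int).

Definition gvect : vectType k := {ffun I -> k^o}.

Definition gbasis (i : I) : gvect := [ffun j => (j == i)%:R].

Definition Sdual := symalg k (fun i => 1 - deg i).

(* The operation lambda_n : h^(x)n -> h of a derivation D of S(h^*[-1]): the
   transpose of the component h^*[-1] -> S^n(h^*[-1]) of D is a map
   S^n(h[1]) -> h[1], and the sign is that of the n-fold suspension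
     e_1 (x) ... (x) e_n |-> (-1)^(sum_l (n-l)|e_l|) s e_1 ... s e_n. *)
Definition Linfty_op (D : Sdual -> Sdual) (n : nat) (v : 'I_n -> gvect) : gvect :=
  [ffun i => \sum_(j : {ffun 'I_n -> I})
     (-1) ^ (\sum_(l < n) (n - l.+1)%:Z * deg (j l))
     * (\prod_(l < n) v l (j l)) * symval (D (gen k _ i)) (codom j)].

Definition homog_part (p : int) (x : gvect) : gvect :=
  [ffun i => if deg i == p then x i else 0].

Definition graded_subspace (W : {vspace gvect}) :=
  forall p x, x \in W -> homog_part p x \in W.

Definition Linfty_subalgebra (D : Sdual -> Sdual) (W : {vspace gvect}) :=
  graded_subspace W /\
  forall n (v : 'I_n -> gvect), (0 < n)%N -> (forall l, v l \in W) ->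
    Linfty_op D v \in W.

End Linfty.

Section Convex.
Variables (R : realType) (d : nat).
Local Notation vec := 'rV[R]_d.
Local Open Scope classical_set_scope.

Definition hull (s : seq vec) : set vec :=
  [set x | exists t : vec -> R, [/\ forall y, 0 <= t y,
     \sum_(y <- s) t y = 1 & x = \sum_(y <- s) t y *: y]].

(* (1, x), so that affine independence is linear independence *)
Definition homogenize (x : vec) : 'rV[R]_(1 + d) := row_mx 1%:M x.

(* 1 + the dimension of the affine span *)
Definition affrank (s : seq vec) : nat :=
  \rank (\matrix_(i < size s) homogenize s`_i).

Definition dotp (x : vec) (u : 'cV[R]_d) : R := (x *m u) 0 0.

(* u = 0 gives Q itself and the empty face. *)
Definition face_of (F Q : set vec) :=
  exists (u : 'cV[R]_d) (c : R), (forall x, Q x -> dotp x u <= c) /\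
    F = [set x | Q x /\ dotp x u = c].

Definition affine_on (D : set vec) (f : vec -> R) :=
  exists (u : 'cV[R]_d) (c : R), forall x, D x -> f x = dotp x u + c.

Definition affine_domain (f : vec -> R) (Q D : set vec) :=
  [/\ D `<=` Q, convex_set D & affine_on D f].

Definition maximal_affine_domain (f : vec -> R) (Q D : set vec) :=
  affine_domain f Q D /\
  forall D', affine_domain f Q D' -> D `<=` D' -> D' = D.

End Convex.

(** A polytope in a vector space is given here by a list of points of which it
   is the convex hull.  An orientation of a polytope F is represented by an
   ordered basis of the direction space of its affine span; bases with the same
   orientation give the same generator of or(F) = H_c^{dim F}(Int F, k), and
   bases with opposite orientations give opposite generators. *)

Section Orientation.
Variables (R : realType) (W : vectType R).

Definition dirspace (s : seq W) : {vspace W} :=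
  <<[seq x - y | x <- s, y <- s]>>%VS.

Definition pdim (s : seq W) : nat := \dim (dirspace s).

Definition centroid (s : seq W) : W := (size s)%:R^-1 *: \sum_(x <- s) x.

(* The sign of the ordered basis Y relative to the ordered basis X of the same
   space; 0 if the lengths differ. *)
Definition rel_sign (X Y : seq W) : int :=
  if size Y == size X then
    sgz (\det (\matrix_(i < size X, j < size X) coord (in_tuple X) j Y`_i))
  else 0.

End Orientation.

Section Marked.
Variables (R : realType) (d : nat) (A : {fset 'rV[R]_d}).
Local Open Scope classical_set_scope.

Definition pts (B : {set A}) : seq 'rV[R]_d := [seq val a | a <- enum B].

Definition Conv (B : {set A}) : set 'rV[R]_d := hull (pts B).

Definition general_position :=
  forall B : {set A}, (#|B| <= d.+1)%N -> affrank (pts B) = #|B|.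

Definition affinely_spanning := affrank (pts [set: A]%SET) = d.+1.

(* The marked subpolytope (Conv B, B) of full dimension d. *)
Record marked := Marked {
  marks :> {set A};
  marked_full : affrank (pts marks) == d.+1 }.

HB.instance Definition _ := [isSub for marks].
HB.instance Definition _ := [Finite of marked by <:].

Implicit Types (B C : marked) (P T : {set marked}).

Definition is_geometric B :=
  (B : {set A}) == [set a : A | `[< Conv B (val a) >]]%SET.

Definition subdivision B P :=
  [/\ forall C, C \in P -> (C : {set A}) \subset B,
      \bigcup_(C in [set` P]) Conv C = Conv B,
      forall C C', C \in P -> C' \in P ->
        face_of (Conv C `&` Conv C') (Conv C) /\
        face_of (Conv C `&` Conv C') (Conv C')
    & forall C C', C \in P -> C' \in P -> forall a : A,
        (Conv C `&` Conv C') (val a) ->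
        (a \in (C : {set A})) = (a \in (C' : {set A}))].

Definition regular_subdivision B P :=
  subdivision B P /\
  exists f : 'rV[R]_d -> R,
    [/\ {within Conv B, continuous f}, convex_function (Conv B) f
      & forall D, maximal_affine_domain f (Conv B) D <->
                  exists2 C, C \in P & D = Conv C].

(* A full-dimensional simplex marked by its vertices has d + 1 marked points. *)
Definition regular_triangulation B T :=
  regular_subdivision B T /\ forall C, C \in T -> #|C| = d.+1.

Definition refines P P' :=
  forall C, C \in P -> exists2 C', C' \in P' & (C : {set A}) \subset C'.

(* Euclidean volume, for C the set of the d + 1 vertices of a simplex. *)
Definition vol (C : {set A}) : R :=
  `|\det (\matrix_(i < 1 + d) homogenize (pts C)`_i)| / d`!%:R.

Definition RA : vectType R := {ffun A -> R^o}.

Definition phi T : RA :=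
  [ffun a => \sum_(C in T | a \in (C : {set A})) vol C].

(* R^B is the subspace of R^A of the functions that vanish outside B. *)
Definition secondary B : seq RA :=
  [seq phi T | T <- enum {set marked} & `[< regular_triangulation B T >]].

(* The face F_P: its vertices are the phi_T for T a refinement of P. *)
Definition secondary_face B P : seq RA :=
  [seq phi T | T <- enum {set marked}
     & `[< regular_triangulation B T /\ refines T P >]].

Definition coarse B P :=
  regular_subdivision B P /\
  (pdim (secondary_face B P)).+1 = pdim (secondary B).

Definition orientation_choice (o : marked -> seq RA) :=
  forall B, basis_of (dirspace (secondary B)) (o B).

(* The coefficient of the cellular boundary at the facet F_P, for the
   orientation o of the secondary polytope of B and the product orientation of
   F_P = prod_(C in P) Sigma(C), with the outward normal first.  The isomorphism
   of the product with F_P is the restriction of the sum map of R^A, so that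
   the product orientation is obtained by concatenating bases; the vector from
   the centroid of the vertices of Sigma(B) to that of the vertices of F_P
   points outwards. *)
Definition incidence (o : marked -> seq RA) B P : int :=
  rel_sign (o B)
    ((centroid (secondary_face B P) - centroid (secondary B))
       :: flatten [seq o C | C : marked <- enum P]).

(* The degree of E_B = or(Sigma(B))^*[-1 - dim Sigma(B)].  The line E_B is spanned
   by gbasis B, the dual of the generator of or(Sigma(B)) given by o B, and V_B
   by gen B, the generator itself placed in degree - dim Sigma(B). *)
Definition Edeg B : int := (pdim (secondary B)).+1%:Z.

Section Differential.
Variable k : fieldType.
Variable o : marked -> seq RA.

Definition coarse_component B P : Sdual k Edeg :=
  (incidence o B P)%:~R *: \prod_(C <- enum P) gen k _ C.

Definition dgen B : Sdual k Edeg :=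
  \sum_(P : {set marked} | `[< coarse B P >]) coarse_component B P.

Definition dA : Sdual k Edeg -> Sdual k Edeg := derivation dgen.

Lemma dgen_homog : orientation_choice o ->
  forall B, homog (1 - Edeg B + 1) (dgen B).
Proof.
move=> oP B; rewrite /dgen; apply: (big_ind (homog (1 - Edeg B + 1))).
- exact: homog0.
- by move=> f h; exact: homogD.
move=> P _; rewrite /coarse_component /incidence /rel_sign.
case: eqP => [sz|_]; last by rewrite scale0r; exact: homog0.
apply: homogZ.
have szo C : size (o C) = pdim (secondary C).
  by have /andP[/eqP oC /eqP fr] := oP C; rewrite -fr oC.
have -> : 1 - Edeg B + 1 = \sum_(C <- enum P) (1 - Edeg C).
  rewrite /Edeg -(szo B) -sz /= size_flatten /shape -map_comp sumnE big_map.
  rewrite -addn2 !PoszD (big_morph Posz PoszD erefl) opprD addrA.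
  have -> : 1 - (\sum_(C <- enum P) (size (o C))%:Z) - 2 + 1
      = - (\sum_(C <- enum P) (size (o C))%:Z) by lia.
  rewrite -sumrN; apply: eq_bigr => C _; rewrite szo; lia.
elim: (enum P) => [|C s IH]; first by rewrite !big_nil; exact: homog1.
by rewrite !big_cons; apply: homogM => //; exact: homog_gen.
Qed.

Lemma dA_gen B : dA (gen k _ B) = dgen B.
Proof. exact: derivation_gen. Qed.

Lemma dAM f h : orientation_choice o ->
  dA (f * h) = dA f * h + koszul 1 f * dA h.
Proof. by move=> oP; apply: derivationM; exact: dgen_homog. Qed.

Definition gA : {vspace gvect k marked} :=
  (\sum_(B : marked | is_geometric B) <[gbasis k B]>)%VS.

End Differential.
End Marked.

Arguments dA {R d A} k o f.
Arguments gA {R d} A k.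

(* Main.v *)
Require Import Defs.
From mathcomp Require Import all_boot all_order all_algebra finmap.
From mathcomp Require Import all_classical all_reals all_analysis.
Import GRing.Theory Num.Theory.
Local Open Scope ring_scope.

(** The structure constants of the operations are the coefficients of the
   differential: the component of [lambda_n (E_C1, ..., E_Cn)] in [E_B] is, up
   to sign, the coefficient of the monomial [C1 ... Cn] in [d B], and it can be
   nonzero only if [C1, ..., Cn] are, in some order, the members of a coarse
   subdivision of [B] ([dgen_support]).

   If all members of a subdivision of [B] are geometric, so is [B]: a point of
   [A] in [Conv B] lies in the polytope of some member, hence is marked there,
   and the marks of a member are marks of [B] ([geometric_subdivision]).  So an
   operation on geometric summands has no nongeometric component.

   For the differential the subdivision has a single member [C], with the same
   polytope as [B].  When [C] and hence [B] are geometric, both have as marks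
   the points of [A] in that polytope, so [C = B]; but the trivial subdivision
   of [B] corresponds to the whole of the secondary polytope, which is not a
   facet ([coarse_not_trivial]). *)

Section Monomials.
Variables (k : fieldType) (I : finType) (deg : I -> int).

(** The shuffle product of tensors supported on orderings of two words is
   supported on orderings of their concatenation. *)
Lemma prod_gen_support (s w : seq I) :
  symval (\prod_(i <- s) gen k deg i) w != 0 -> perm_eq s w.
Proof.
elim: s w => [|i s IH] w.
  rewrite big_nil; case: w => // a w.
  (* The value of the unit at a nonempty word is 0 by definition. *)
  by change ((0 : k) != 0 -> perm_eq [::] (a :: w)); rewrite eqxx.
rewrite big_cons symvalM; apply: contraNT => sw; apply/eqP.
apply: shmul_eq0 => u v uvw /=.
have [u_i|_] := eqVneq u [:: i]; last by rewrite mul0r.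
have [->|/IH sv] := eqVneq (symval (\prod_(j <- s) gen k deg j) v) 0.
  by rewrite mulr0.
case/negP: sw; apply: perm_trans uvw.
by rewrite u_i /= perm_cons.
Qed.

Lemma symval_sum (J : finType) (P : pred J) (F : J -> symalg k deg) w :
  symval (\sum_(j | P j) F j) w = \sum_(j | P j) symval (F j) w.
Proof.
by apply: (big_morph (fun f => symval f w)).
Qed.

End Monomials.

Section Geometric.
Set Implicit Arguments.
Unset Strict Implicit.
Variables (R : realType) (d : nat) (A : {fset 'rV[R]_d}).
Implicit Types (B C : marked A) (P : {set marked A}).

Lemma Conv_mark B (a : A) : a \in (B : {set A}) -> Conv B (val a).
Proof.
move=> aB; exists (fun y => (y == val a)%:R); split.
- by move=> y; exact: ler0n.
- rewrite /pts big_map (bigD1_seq a) ?mem_enum ?enum_uniq //= eqxx.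
  by rewrite big1 ?addr0 // => b ba; rewrite (inj_eq val_inj) (negbTE ba).
- rewrite /pts big_map (bigD1_seq a) ?mem_enum ?enum_uniq //= eqxx scale1r.
  rewrite big1 ?addr0 // => b ba.
  by rewrite (inj_eq val_inj) (negbTE ba) scale0r.
Qed.

Lemma geometricP B (a : A) :
  is_geometric B -> (a \in (B : {set A})) = `[< Conv B (val a) >].
Proof. by move=> /eqP BE; rewrite {1}BE inE. Qed.

(** Polytopes of the members cover [Conv B] while their marks come from [B], so
   no point of [A] in [Conv B] can be left unmarked in [B]. *)
Lemma geometric_subdivision B P :
  subdivision B P -> (forall C, C \in P -> is_geometric C) -> is_geometric B.
Proof.
move=> [Psub Pcover _ _] Pgeo; apply/eqP/setP => a; rewrite inE.
apply/idP/asboolP; first exact: Conv_mark.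
rewrite -Pcover => -[C /= CP Ca]; apply: (fintype.subsetP (Psub C CP)).
by rewrite geometricP ?Pgeo //; apply/asboolP.
Qed.

Lemma geometric_inj B C :
  is_geometric B -> is_geometric C -> Conv B = Conv C -> B = C.
Proof.
move=> Bgeo Cgeo BC; apply: val_inj; apply/setP => a /=.
by rewrite !geometricP // BC.
Qed.

(** Every triangulation of [B] refines the trivial subdivision, whose face is
   therefore the whole secondary polytope instead of a facet. *)
Lemma coarse_not_trivial B : ~ coarse B [set B]%SET.
Proof.
move=> [_]; suff -> : secondary_face B [set B]%SET = secondary B.
  by move=> /esym; exact: n_Sn.
rewrite /secondary_face /secondary; congr map; apply: eq_filter => T.
apply: asbool_equiv_eq; split=> [[]//|BT]; split=> // C CT.
by exists B; [rewrite inE | have [[[Tsub _ _ _] _] _] := BT; exact: Tsub].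
Qed.

Variables (k : fieldType) (o : marked A -> seq (RA A)).

(** The summand of the differential at [P] is a multiple of the product of the
   generators of the members of [P], a tensor supported on the orderings of
   [P]. *)
Lemma dgen_support B (w : seq (marked A)) :
  symval (dgen k o B) w != 0 -> exists2 P, coarse B P & perm_eq (enum P) w.
Proof.
move=> nz; apply/not_exists2P => nP; case/eqP: nz.
rewrite /dgen symval_sum big1 // => P /asboolP cP.
rewrite /coarse_component symvalZ.
apply/eqP; rewrite mulf_eq0; apply/orP; right.
by apply: contraT => /prod_gen_support Pw; have [] := nP P.
Qed.

Lemma mem_gA (x : gvect k (marked A)) :
  x \in gA A k <-> forall B, ~~ is_geometric B -> x B = 0.
Proof.
split=> [/memv_sumP[u uP ->] B nB | x0].
  rewrite sum_ffunE big1 // => C gC; have /vlineP[c ->] := uP C gC.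
  rewrite !ffunE [B == C]negbTE ?scaler0 //.
  by apply: contraNneq nB => ->.
have -> : x = \sum_(B | is_geometric B) x B *: gbasis k B.
  apply/ffunP => B; rewrite sum_ffunE.
  have [gB|nB] := boolP (is_geometric B).
    rewrite (bigD1 B) //= big1 => [|C /andP[_ CB]]; rewrite !ffunE.
      by rewrite eqxx addr0 [RHS]mulr1.
    by rewrite eq_sym (negbTE CB) scaler0.
  rewrite x0 // big1 // => C gC; rewrite !ffunE [B == C]negbTE ?scaler0 //.
  by apply: contraNneq nB => ->.
apply: memv_sumr => B gB; apply: memvZ; exact: memv_line.
Qed.

(** A nonzero component comes from a word at which neither the arguments nor the
   differential of the generator [B] vanish: the arguments make its letters
   geometric, the differential makes them the members of a coarse subdivision,
   each occurring once. *)
Lemma Linfty_op_gA_support n (v : 'I_n -> gvect k (marked A)) B :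
    (forall l, v l \in gA A k) -> Linfty_op (dA k o) v B != 0 ->
  exists P, [/\ coarse B P, forall C, C \in P -> is_geometric C & #|P| = n].
Proof.
move=> vA; rewrite ffunE => nz; apply/not_existsP => nP; case/eqP: nz.
apply: big1 => j _; apply/eqP; apply: contraT.
rewrite !mulf_eq0 !negb_or => /andP[/andP[_ vj]].
rewrite dA_gen => /dgen_support[P cP Pj]; case: (nP P); split=> // [C|].
  rewrite -mem_enum (perm_mem Pj) => /codomP[l ->].
  apply: contraNT vj => nj; rewrite (bigD1 l) //=.
  by have /mem_gA -> := vA l; rewrite ?mul0r.
by rewrite cardE (perm_size Pj) size_codom card_ord.
Qed.

End Geometric.

Theorem proposition3p2 (R : realType) (d : nat) (A : {fset 'rV[R]_d})
  (k : fieldType) (k_char0 : [pchar k] =i pred0)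
  (A_general : general_position A) (A_spanning : affinely_spanning A)
  (o : marked A -> seq (RA A)) (o_orientation : orientation_choice o) :
  Linfty_subalgebra (dA k o) (gA A k) /\
  (forall x : gvect k (marked A), x \in gA A k ->
     Linfty_op (dA k o) (fun _ : 'I_1 => x) = 0).
Proof.
split; first split.
- move=> p x /mem_gA x0; apply/mem_gA => B nB.
  by rewrite ffunE x0 // if_same.
- move=> n v _ vA; apply/mem_gA => B nB; apply/eqP; apply: contraNT nB.
  move=> /(Linfty_op_gA_support vA)[P [[[sP _] _] Pgeo _]].
  exact: geometric_subdivision sP Pgeo.
move=> x xA; apply/ffunP => B; rewrite [RHS]ffunE; apply/eqP; apply: contraT.
move=> /(Linfty_op_gA_support (fun=> xA))[P [cP Pgeo /eqP]].
move=> /cards1P[C PC].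
(* The single member has the polytope of [B], and both are geometric. *)
have [[sP _] _] := cP; have Bgeo := geometric_subdivision sP Pgeo.
have BC : B = C.
  apply: geometric_inj => //; first by apply: Pgeo; rewrite PC set11.
  have [_ <- _ _] := sP; rewrite PC eqEsubset; split=> y.
    by move=> [C' /=]; rewrite inE => /eqP ->.
  by move=> Cy; exists C => //=; rewrite inE.
by case: (@coarse_not_trivial _ _ _ B); rewrite {2}BC -PC.
Qed.
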